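(* For all integers $d,n\ge1$, the relative volumes of hypersimplices satisfy $$\sum_{p=1}^{d} v(d,p)\binom{n+d-p}{n-p} = n^d,$$ where $\binom{n+d-p}{n-p}=0$ whenever $n-p<0$.
   Context: Let $x_0,\ldots,x_d\in\mathbb{R}^d$ be affinely independent and $\Delta=\mathrm{conv}\{x_0,\ldots,x_d\}$. For $1\le p\le d$, a $p$-fold sum is the vector sum of $p$ distinct points among $x_0,\ldots,x_d$; the $d$-hypersimplex of order $p$, $\Delta_d^{(p)}$, is the convex hull of all $p$-fold sums. The relative volume is $v(d,p)=\mathrm{vol}_d(\Delta_d^{(p)})/\mathrm{vol}_d(\Delta)$, which does not depend on the choice of $\Delta$. *)

(* Defs.v *)
From HB Require Import structures.
From mathcomp Require Import all_boot all_order all_algebra.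
From mathcomp Require Import all_classical all_reals all_analysis.

Set Implicit Arguments.
Unset Strict Implicit.
Unset Printing Implicit Defensive.

Import Order.TTheory GRing.Theory Num.Theory.
Import numFieldNormedType.Exports.

Local Open Scope classical_set_scope.
Local Open Scope ring_scope.

Section lebesgue_measure_tuple.
Context {R : realType}.
Local Notation mR := (measurableTypeR R).
Local Open Scope ereal_scope.

Definition cons_pair n (z : (mR * n.-tuple mR)%type) : n.+1.-tuple mR :=
  [tuple of z.1 :: z.2].

Lemma measurable_cons_pair n : measurable_fun setT (@cons_pair n).
Proof. exact: measurable_cons. Qed.

Definition cons_measure n (mu : set (n.-tuple mR) -> \bar R) :
    set (n.+1.-tuple mR) -> \bar R :=
  pushforward (lebesgue_measure \x mu) (@cons_pair n).

Section cons_measure_sigma_finite.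
Context n (mu : {sigma_finite_measure set (n.-tuple mR) -> \bar R}).

Let cons_measure0 : cons_measure mu set0 = 0.
Proof. by rewrite /cons_measure /pushforward preimage_set0 measure0. Qed.

Let cons_measure_ge0 A : 0 <= cons_measure mu A.
Proof. by rewrite /cons_measure /pushforward measure_ge0. Qed.

Let cons_measure_sigma_additive : semi_sigma_additive (cons_measure mu).
Proof.
move=> F mF tF mUF; rewrite /cons_measure /pushforward preimage_bigcup.
have mpre A : measurable A -> measurable (@cons_pair n @^-1` A).
  by move=> mA; rewrite -[X in measurable X]setTI; exact: measurable_cons_pair.
apply: measure_semi_sigma_additive.
- by move=> i; exact: mpre.
- apply/trivIsetP => /= i j _ _ ij; rewrite -preimage_setI.
  by move/trivIsetP : tF => /(_ _ _ _ _ ij) ->//; rewrite preimage_set0.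
- by rewrite -preimage_bigcup; exact: mpre.
Qed.

HB.instance Definition _ := isMeasure.Build _ _ _ (cons_measure mu)
  cons_measure0 cons_measure_ge0 cons_measure_sigma_additive.

Let cons_measure_sigma_finite : sigma_finite setT (cons_measure mu).
Proof.
have /sigma_finiteP[F [TF ndF Foo]] := sigma_finiteT (@lebesgue_measure R).
have /sigma_finiteP[G [TG ndG Goo]] := sigma_finiteT mu.
pose box i : set (n.+1.-tuple mR) :=
  [set t | F i (tnth t ord0) /\ G i [tuple of behead t]].
exists box.
  apply/seteqP; split => // t _.
  have [i _ Fi] : (\bigcup_i F i) (tnth t ord0) by rewrite -TF.
  have [j _ Gj] : (\bigcup_i G i) [tuple of behead t] by rewrite -TG.
  exists (maxn i j) => //; split.
    by move: Fi; apply/subsetPset/ndF/leq_maxl.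
  by move: Gj; apply/subsetPset/ndG/leq_maxr.
move=> i; have [mF Fi] := Foo i; have [mG Gi] := Goo i; split.
  apply: measurableI.
    by rewrite -[X in measurable X]setTI; exact: measurable_tnth.
  by rewrite -[X in measurable X]setTI; exact: measurable_behead.
rewrite /cons_measure /pushforward.
rewrite (_ : _ @^-1` _ = F i `*` G i); last first.
  apply/seteqP; split => -[a b] [/= ? Gb]; split => //=; move: Gb;
    by congr (G i _); apply/val_inj.
by rewrite product_measure1E// lte_mul_pinfty// ge0_fin_numE.
Qed.

HB.instance Definition _ := Measure_isSigmaFinite.Build _ _ _
  (cons_measure mu) cons_measure_sigma_finite.

End cons_measure_sigma_finite.

(* The n-fold product of the one-dimensional Lebesgue measure, that is, the
   Lebesgue measure on the Borel sets of R^n; see the value on boxes below. *)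
Fixpoint lebesgue_measure_tuple n :
    {sigma_finite_measure set (n.-tuple mR) -> \bar R} :=
  match n with
  | 0 => dirac ([tuple] : 0.-tuple mR)
  | m.+1 => cons_measure (lebesgue_measure_tuple m)
  end.

Lemma lebesgue_measure_tuple_box n (A : 'I_n -> set mR) :
  (forall i, measurable (A i)) ->
  lebesgue_measure_tuple n [set t | forall i, A i (tnth t i)] =
  \prod_(i < n) lebesgue_measure (A i).
Proof.
elim: n A => [|n IH] A mA /=.
  by rewrite big_ord0 diracE mem_set//= => -[].
rewrite big_ord_recl -IH// /cons_measure /pushforward -product_measure1E//=.
  congr (_ _); apply/seteqP; split => -[a b] /=.
    move=> H; split; first exact: (H ord0).
    by move=> i; have := H (lift ord0 i); rewrite tnthS.
  move=> [Aa Ab] i; case: (unliftP ord0 i) => [j|] ->//.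
  by rewrite tnthS.
have -> : [set t | forall i, A (lift ord0 i) (tnth t i)] =
  \bigcap_(i in [set: 'I_n])
    ((fun t : n.-tuple mR => tnth t i) @^-1` A (lift ord0 i)).
  by apply/seteqP; split => t /= H i; [move=> _|]; exact: H.
apply: fin_bigcap_measurable => //.
move=> i _; rewrite -[X in measurable X]setTI; exact: measurable_tnth.
Qed.

End lebesgue_measure_tuple.

(* The product sigma-algebra is available on tuples, the vector space structure
   on row vectors: 'rV[R]_d is identified with d.-tuple R coordinatewise. *)
Definition vol {R : realType} (d : nat) (A : set 'rV[R]_d) : \bar R :=
  lebesgue_measure_tuple d [set t | A (\row_i tnth t i)].

Section hypersimplex.
Context {R : realType}.

Definition affinely_independent (V : lmodType R) (m : nat) (x : 'I_m -> V) :=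
  forall c : 'I_m -> R,
    \sum_i c i = 0 -> \sum_i c i *: x i = 0 -> forall i, c i = 0.

Definition convex_hull (V : lmodType R) (A : set V) : set V :=
  smallest (@convex_set R V) A.

Definition simplex (V : lmodType R) (m : nat) (x : 'I_m -> V) : set V :=
  convex_hull (range x).

(* When x is affinely independent it is injective, so that a sum over p distinct
   indices is a sum of p distinct points. *)
Definition p_fold_sums (V : lmodType R) (m p : nat) (x : 'I_m -> V) : set V :=
  [set y | exists2 S : {set 'I_m}, #|S| = p & y = \sum_(i in S) x i].

Definition hypersimplex (V : lmodType R) (m p : nat) (x : 'I_m -> V) : set V :=
  convex_hull (p_fold_sums p x).

Definition relvol (d p : nat) (x : 'I_d.+1 -> 'rV[R]_d) : R :=
  fine (vol (hypersimplex p x)) / fine (vol (simplex x)).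

End hypersimplex.

(* Main.v *)
(* In the barycentric coordinates of a dilation n Delta the coordinates are
   nonnegative and sum to n. Splitting each of them into its integer part k_i and
   its fractional part cuts n Delta into pieces: the one with integer parts k is
   the translate by sum_i k_i x_i of the points whose coordinates lie in [0, 1[
   and sum to p = n - sum_i k_i. Up to a null set the latter is the hypersimplex
   of order p, and there are 'C(n + d - p, n - p) vectors k for each p. Comparing
   volumes gives the identity, since vol (n Delta) = n ^ d vol Delta. *)
From HB Require Import structures.
Require Import Defs.
From mathcomp Require Import all_boot all_order all_algebra.
From mathcomp Require Import all_classical all_reals all_analysis.
From mathcomp Require Import measurable_realfun ring lra zify.

Set Implicit Arguments.
Unset Strict Implicit.
Unset Printing Implicit Defensive.

Import Order.TTheory GRing.Theory Num.Theory.

Local Open Scope classical_set_scope.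
Local Open Scope ring_scope.

(** * Lebesgue measure on tuples: homotheties, translations and hyperplanes *)

Section lebesgue_tuple.
Context {R : realType}.
Local Notation mR := (measurableTypeR R).
Local Notation leb := (@lebesgue_measure R).
Local Open Scope ereal_scope.

Lemma measurable_affine (c a : R) :
  measurable_fun [set: mR] (fun x : mR => (c * x + a)%R : mR).
Proof. by apply: measurable_funD => //; exact: measurable_funM. Qed.

(** By uniqueness of Lebesgue measure: [c] times the push-forward has the right value on every
    interval []u, v]]. *)
Lemma lebesgue_measure_affine (c a : R) (A : set mR) : (0 < c)%R ->
  measurable A ->
  leb ((fun x : mR => (c * x + a)%R : mR) @^-1` A) = (c^-1)%:E * leb A.
Proof.
move=> c0 mA; pose f (x : mR) : mR := (c * x + a)%R.
have mf : measurable_fun setT f := measurable_affine c a.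
pose nu : {measure set mR -> \bar R} :=
  mscale (NngNum (ltW c0)) (pushforward leb f).
suff -> : leb A = nu mf A.
  rewrite /nu /mscale/= muleA -EFinM mulVf ?gt_eqF// mul1e //.
apply: lebesgue_measure_unique mA => /= _ [[u v]] _ <-.
rewrite /nu /mscale/= /pushforward/=.
have -> : f @^-1` `]u, v] = `]((u - a) / c)%R, ((v - a) / c)%R]%classic.
  apply/seteqP; split => x; rewrite /f /= !in_itv/=.
    move=> /andP[h1 h2]; apply/andP; split.
      by rewrite ltr_pdivrMr// ltrBlDr mulrC.
    by rewrite ler_pdivlMr// lerBrDr mulrC.
  by rewrite ltr_pdivrMr// ltrBlDr ler_pdivlMr// lerBrDr mulrC.
rewrite !lebesgue_measure_itv/= !lte_fin ltr_pM2r ?invr_gt0// ltrD2r.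
case: ifPn => uv; last by rewrite mule0.
rewrite -!EFinB -EFinM; congr EFin.
by rewrite -mulrBl mulrCA mulfV ?gt_eqF// mulr1; lra.
Qed.

Definition affine_tuple n (c : R) (v : 'I_n -> R) (t : n.-tuple mR) :
  n.-tuple mR := [tuple (c * tnth t i + v i)%R | i < n].

Lemma affine_tuple_cons n (c : R) (v : 'I_n.+1 -> R) (x : mR) (t : n.-tuple mR) :
  affine_tuple c v (cons_pair (x, t)) =
  cons_pair ((c * x + v ord0)%R : mR, affine_tuple c (fun i => v (lift ord0 i)) t).
Proof.
apply: eq_from_tnth => i; rewrite tnth_mktuple.
case: (unliftP ord0 i) => [j ->|->]; last by [].
by rewrite !tnthS tnth_mktuple.
Qed.

(** Fubini and induction: each section of the preimage contributes [c ^- n], and the substitution in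
    the first coordinate one more [c^-1]. *)
Lemma lebesgue_measure_tuple_affine n (c : R) (v : 'I_n -> R)
    (A : set (n.-tuple mR)) : (0 < c)%R -> measurable A ->
  lebesgue_measure_tuple n (affine_tuple c v @^-1` A) =
  (c ^- n)%:E * lebesgue_measure_tuple n A.
Proof.
move=> c0; elim: n v A => [|n IH] v A mA /=.
  rewrite expr0 invr1 mul1e !diracE; congr ((_ \in _)%:R%:E).
  apply/seteqP; split=> t /=; by rewrite (tuple0 (affine_tuple _ _ _)) (tuple0 t).
rewrite /cons_measure /pushforward.
have mB : measurable (@cons_pair R n @^-1` A).
  by rewrite -[X in measurable X]setTI; exact: measurable_cons_pair.
set B := _ @^-1` A in mB *.
pose g x := lebesgue_measure_tuple n (xsection B x).
pose f (x : mR) : mR := (c * x + v ord0)%R.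
have mf : measurable_fun setT f by exact: measurable_affine.
have mg : measurable_fun setT g by exact: measurable_fun_xsection.
have g0 x : 0 <= g x by exact: measure_ge0.
pose w (i : 'I_n) := v (lift ord0 i).
rewrite /product_measure1.
transitivity (\int[leb]_x ((c ^- n)%:E * (g \o f) x)).
  apply: eq_integral => x _ /=; rewrite /g -(IH w); last first.
    exact: measurable_xsection.
  have -> : xsection (@cons_pair R n @^-1` (affine_tuple c v @^-1` A)) x =
      affine_tuple c w @^-1` xsection B (f x).
    by apply/seteqP; split => t; rewrite /xsection/= !inE /B/= affine_tuple_cons.
  by [].
have mgf : measurable_fun setT (g \o f) by exact: measurableT_comp mg mf.
have gf0 x : [set: mR] x -> 0 <= (g \o f) x by move=> _; exact: g0.
have cn0 : 0 <= (c ^- n)%:E by rewrite lee_fin invr_ge0 exprn_ge0 // ltW.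
rewrite (ge0_integralZl leb measurableT mgf gf0 cn0).
transitivity ((c ^- n)%:E * \int[pushforward leb f]_x g x).
  by rewrite ge0_integral_pushforward.
have ci0 : (0 <= c^-1)%R by rewrite invr_ge0 ltW.
rewrite (eq_measure_integral (mscale (NngNum ci0) leb)); last first.
  by move=> X mX _; rewrite [LHS](lebesgue_measure_affine (v ord0) c0 mX).
by rewrite ge0_integral_mscale//= muleA -EFinM -invfM -exprSr.
Qed.

(** If a coefficient after the first is nonzero, all sections along the first coordinate are
    hyperplanes, null by induction. Otherwise the set is a point times the whole space. *)
Lemma lebesgue_measure_tuple_hyperplane n (a : 'I_n -> R) (b : R) :
  (exists i, a i != 0)%R ->
  lebesgue_measure_tuple n [set t | \sum_i a i * tnth t i = b]%R = 0.
Proof.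
elim: n a b => [a b [[]//]|n IH a b ha] /=.
rewrite /cons_measure /pushforward.
pose a' (i : 'I_n) := a (lift ord0 i).
have e (z : mR * n.-tuple mR) :
    (\sum_i a i * tnth (cons_pair z) i = a ord0 * z.1 + \sum_i a' i * tnth z.2 i)%R.
  by rewrite big_ord_recl; congr +%R; apply: eq_bigr => i _; rewrite tnthS.
have [a'0|a'0] := pselect (exists i, a' i != 0)%R.
  rewrite /product_measure1 integral0_eq// => x _ /=.
  rewrite -[RHS](IH a' (b - a ord0 * x)%R a'0); congr (lebesgue_measure_tuple n _).
  apply/seteqP; split => t; rewrite /xsection/= !inE/= e /=.
    by move=> <-; rewrite addrC addKr.
  by move=> ->; rewrite addrC subrK.
have a'E i : a' i = 0%R by apply/eqP/negPn/negP => h; apply: a'0; exists i.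
have a00 : (a ord0 != 0)%R.
  case: ha => i; case: (unliftP ord0 i) => [j ->|->]//.
  by rewrite -/(a' j) a'E eqxx.
rewrite [X in product_measure1 _ _ X](_ : _ = [set (b / a ord0)%R] `*` setT).
  have ms : measurable ([set (b / a ord0)%R] : set mR) by exact: measurable_set1.
  rewrite [LHS](product_measure1E leb (lebesgue_measure_tuple n) ms measurableT).
  (* The second factor may be infinite; in [\bar R] its product with 0 is still 0. *)
  rewrite -[RHS](mul0e (lebesgue_measure_tuple n setT)); congr (_ * _).
  exact: lebesgue_measure_set1.
apply/seteqP; split => -[x t] /=; rewrite e /=.
  rewrite big1 ?addr0; first by move=> <-; split => //; rewrite mulrC mulKf.
  by move=> i _; rewrite a'E mul0r.
move=> [-> _]; rewrite mulrC divfK// big1 ?addr0//.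
by move=> i _; rewrite a'E mul0r.
Qed.

End lebesgue_tuple.

(** * Barycentric coordinates with prescribed sum *)

Section barycentric.
Context {R : realType} {d : nat}.
Variable x : 'I_d.+1 -> 'rV[R]_d.

(* Row i is (1, x_i), so that (s, y) is c *m vertex_mx exactly when the weights c
   sum to s and sum_i c_i x_i = y. *)
Definition vertex_mx : 'M[R]_(1 + d) := \matrix_i row_mx 1%:M (x i).

(* The coefficients of y on the x_i normalised to have sum s; they are the usual
   barycentric coordinates when s = 1. *)
Definition bary (s : R) (y : 'rV[R]_d) (i : 'I_d.+1) : R :=
  (row_mx s%:M y *m invmx vertex_mx) 0 i.

Lemma mul_vertex_mx (c : 'rV[R]_(1 + d)) :
  c *m vertex_mx = row_mx (\sum_i c 0 i)%:M (\sum_i c 0 i *: x i).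
Proof.
rewrite mulmx_sum_row.
under eq_bigr do rewrite rowK scale_row_mx scalemx1.
apply/rowP => j; rewrite summxE; case: (splitP j) => k jk.
  have -> : j = lshift d k by exact/val_inj.
  rewrite row_mxEl ord1 mxE eqxx mulr1n.
  by apply: eq_bigr => i _; rewrite row_mxEl mxE eqxx mulr1n.
have -> : j = rshift 1 k by exact/val_inj.
rewrite row_mxEr summxE.
by apply: eq_bigr => i _; rewrite row_mxEr.
Qed.

Lemma baryD s s' y y' i : bary (s + s') (y + y') i = bary s y i + bary s' y' i.
Proof. by rewrite /bary raddfD/= -add_row_mx mulmxDl mxE. Qed.

Lemma baryZ a s y i : bary (a * s) (a *: y) i = a * bary s y i.
Proof. by rewrite /bary -scale_scalar_mx -scale_row_mx -scalemxAl mxE. Qed.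

(** This explicit affine form in [y] serves for measurability, for null level sets and for the
    estimate near the centroid. *)
Lemma bary_linear s y i :
  bary s y i = bary s 0 i + \sum_j bary 0 (delta_mx 0 j) i * y 0 j.
Proof.
rewrite -[in LHS](addr0 s) -[in LHS](add0r y) baryD; congr +%R.
rewrite {1}[y]row_sum_delta.
apply: (big_rec2 (fun a b => bary 0 a i = b)) => [|j a b _ <-].
  by rewrite /bary raddf0 row_mx0 mul0mx mxE.
by rewrite -[in LHS](addr0 0) baryD -{1}(mulr0 (y 0 j)) baryZ mulrC.
Qed.

Hypothesis hx : affinely_independent x.

(** A vector in the left kernel is a family of weights with zero sum and zero combination, which
    affine independence forces to vanish. *)
Lemma vertex_mx_unit : vertex_mx \in unitmx.
Proof.
rewrite -row_free_unit; apply: inj_row_free => v.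
rewrite mul_vertex_mx => h.
have /eq_row_mx[h1 h2] := etrans h (esym (row_mx0 R 1 1 d)).
apply/rowP => i; rewrite mxE; apply: (hx _ h2).
by have := congr1 (fun A : 'M[R]_1 => A 0 0) h1; rewrite !mxE eqxx mulr1n.
Qed.

Lemma bary_eq s y :
  row_mx s%:M y = row_mx (\sum_i bary s y i)%:M (\sum_i bary s y i *: x i).
Proof. by rewrite -mul_vertex_mx mulmxKV ?vertex_mx_unit. Qed.

Lemma sum_bary s y : \sum_i bary s y i = s.
Proof.
have /eq_row_mx[/(congr1 (fun A : 'M[R]_1 => A 0 0)) + _] := bary_eq s y.
by rewrite !mxE eqxx !mulr1n.
Qed.

Lemma sum_bary_scale s y : \sum_i bary s y i *: x i = y.
Proof. by have /eq_row_mx[_] := bary_eq s y. Qed.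

Lemma bary_unique s y (c : 'I_d.+1 -> R) :
  \sum_i c i = s -> \sum_i c i *: x i = y -> bary s y =1 c.
Proof.
move=> cs cy i; apply/eqP; rewrite -subr_eq0; apply/eqP; move: i; apply: hx.
  by rewrite sumrB sum_bary cs subrr.
under eq_bigr do rewrite scalerBl.
by rewrite sumrB sum_bary_scale cy subrr.
Qed.

End barycentric.

(** * Hypersimplices as images of slices of the unit cube *)

Section hulls.
Context {R : realType}.

Lemma convex_setP (V : lmodType R) (A : set V) :
  @convex_set R V A <-> forall (u v : V) (t : R), 0 <= t <= 1 -> A u -> A v ->
    A (t *: u + (1 - t) *: v).
Proof.
split=> [h u v t /andP[t0 t1] Au Av|h u v t Au Av].
  have := h u v (Itv01 t0 t1) (mem_set Au) (mem_set Av).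
  by move/set_mem.
apply/mem_set; apply: h; [|exact: set_mem..].
by apply/andP; split; [exact: ge0|exact: le1].
Qed.

Lemma convex_hull_convex (V : lmodType R) (A : set V) (u v : V) (t : R) :
  0 <= t <= 1 -> convex_hull A u -> convex_hull A v ->
  convex_hull A (t *: u + (1 - t) *: v).
Proof.
move=> t01 Au Av B [/= cB AB].
apply: (convex_setP B).1 => //; [exact: Au|exact: Av].
Qed.

Lemma simplex_hypersimplex1 (V : lmodType R) (m : nat) (x : 'I_m -> V) :
  simplex x = hypersimplex 1 x.
Proof.
congr convex_hull; apply/seteqP; split => [_ [i _ <-]|y [S S1 ->]].
  by exists [set i]%SET; rewrite ?cards1// big_set1.
by move/eqP/cards1P : S1 => [i ->]; exists i => //; rewrite big_set1.
Qed.

Section transfer.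
Context {m : nat}.
Implicit Types (c : 'I_m -> R) (i j k : 'I_m).

Definition fractional c : {set 'I_m} := [set k | 0 < c k < 1]%SET.

(** The amount moved from coordinate [j] to coordinate [i] is the largest that keeps both in
    [0, 1]. *)
Definition transfer c i j k : R :=
  c k + Num.min (1 - c i) (c j) * ((k == i)%:R - (k == j)%:R).

Lemma transfer_itv c i j k : (forall k, 0 <= c k <= 1) -> 
  0 <= transfer c i j k <= 1.
Proof.
move=> c01; rewrite /transfer.
have := c01 i; have := c01 j; have := c01 k.
case: eqVneq => [->|ki]; case: eqVneq => [kj|kj] /=; rewrite ?subrr ?mulr0 ?addr0//;
  rewrite ?subr0 ?sub0r ?mulr1 ?mulrN1 -?kj; case: (lerP (1 - c i)) => h; lra.
Qed.

Lemma sum_transfer (V : lmodType R) (x : 'I_m -> V) c i j :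
  \sum_k transfer c i j k *: x k =
  \sum_k c k *: x k + Num.min (1 - c i) (c j) *: (x i - x j).
Proof.
rewrite /transfer; set e := Num.min _ _.
under eq_bigr do rewrite scalerDl -scalerA scalerBl scalerBr.
rewrite big_split/= sumrB scalerBr; congr (_ + (_ - _)).
  rewrite (bigD1 i)//= eqxx scale1r big1 ?addr0// => k /negPf ->.
  by rewrite scale0r scaler0.
rewrite (bigD1 j)//= eqxx scale1r big1 ?addr0// => k /negPf ->.
by rewrite scale0r scaler0.
Qed.

(** Either coordinate [i] reaches 1 or coordinate [j] reaches 0, and the coordinates other than
    these two do not change. *)
Lemma fractional_transfer c i j : i != j -> i \in fractional c ->
  j \in fractional c -> (#|fractional (transfer c i j)| < #|fractional c|)%N.
Proof.
move=> ij; rewrite !inE => ci cj; apply: proper_card; apply/properP; split.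
  apply/fintype.subsetP => k; rewrite !inE /transfer.
  case: (eqVneq k i) => [->//|ki]; case: (eqVneq k j) => [->//|kj].
  by rewrite subrr mulr0 addr0.
have := ci; have := cj; have := ij; rewrite /transfer.
case: (lerP (1 - c i) (c j)) => h ij' cj' ci'.
  exists i; rewrite !inE// eqxx (negPf ij') subr0 mulr1 addrC subrK ltxx andbF//.
exists j; rewrite !inE// eqxx eq_sym (negPf ij') sub0r mulrN1 subrr ltxx//.
Qed.

(* Moving mass between two fractional coordinates, in either direction, until
   one of them becomes integral writes the point as a convex combination of two
   points with fewer fractional coordinates. *)
Lemma hypersimplex_itv (V : lmodType R) (p : nat) (x : 'I_m -> V) c :
  (forall k, 0 <= c k <= 1) -> \sum_k c k = p%:R ->
  hypersimplex p x (\sum_k c k *: x k).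
Proof.
have [N] := ubnP #|fractional c|; elim: N c => // N IH c cN c01 cp.
have int_eq k : k \notin fractional c -> c k = (c k == 1)%:R.
  rewrite !inE => ck; have := c01 k; have [->//|ck1] := eqVneq (c k) 1.
  move=> /andP[c0 c1]; apply/eqP; move: ck; apply: contraR => ck0.
  by rewrite !lt_neqAle c0 c1 ck1 eq_sym ck0.
(* Without fractional coordinates [c] is the indicator of a set of [p] indices, so the point is a
   [p]-fold sum. *)
have [[i ifr]|nofr] := pselect (exists i, i \in fractional c); last first.
  have cE k : c k = (c k == 1)%:R.
    by apply: int_eq; apply/negP => h; apply: nofr; exists k.
  apply: sub_gen_smallest; exists [set k | c k == 1]%SET.
    apply/eqP; rewrite -(eqr_nat R) -cp -sum1_card natr_sum.
    rewrite big_mkcond/=; apply/eqP; apply: eq_bigr => k _.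
    by rewrite inE [RHS]cE; case: ifP.
  rewrite [RHS]big_mkcond; apply: eq_bigr => k _.
  by rewrite inE {1}cE; case: ifP; rewrite ?scale1r ?scale0r.
(* A single fractional coordinate would be the difference of the integers [p] and [q]. *)
have [j jfr ij] : exists2 j, j \in fractional c & i != j.
  apply: contrapT => nj.
  have cE k : k != i -> c k = (c k == 1)%:R.
    move=> ki; apply: int_eq; apply/negP => h; apply: nj; exists k => //.
    by rewrite eq_sym.
  move: cp; rewrite (bigD1 i)//= (eq_bigr (fun k => (c k == 1)%:R)); last first.
    by move=> k ki; exact: cE.
  rewrite -natr_sum; set q := (\sum_(_ | _) _)%N => cpq.
  move: ifr; rewrite inE => /andP[]; have -> : c i = p%:R - q%:R by lra.
  by rewrite subr_gt0 ltrBlDr nat1r !ltr_nat; lia.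
have {}IH i' j' : i' \in fractional c -> j' \in fractional c -> i' != j' ->
    hypersimplex p x (\sum_k transfer c i' j' k *: x k).
  move=> ifr' jfr' ij'; apply: (IH (transfer c i' j')).
  - exact: leq_trans (fractional_transfer ij' ifr' jfr') cN.
  - by move=> k; exact: transfer_itv.
  (* With all points equal to 1 in [R^o], the vector identity says that the sum of the coordinates
     is preserved. *)
  - have := @sum_transfer R^o (fun=> 1) c i' j'.
    rewrite subrr scaler0 addr0 -cp => e; rewrite -[RHS]mulr1 -[LHS]mulr1 !mulr_suml.
    exact: e.
set e := Num.min (1 - c i) (c j); set e' := Num.min (1 - c j) (c i).
have e0 : 0 < e by move: ifr jfr; rewrite !inE /e lt_min => /andP[? ?] /andP[? ?]; lra.
have e'0 : 0 < e' by move: ifr jfr; rewrite !inE /e' lt_min => /andP[? ?] /andP[? ?]; lra.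
have s0 : e + e' != 0 by lra.
(* The two transfers displace the point by [e *: u] and [- e' *: u]; these weights make the
   displacements cancel. *)
have t01 : 0 <= e' / (e + e') <= 1.
  by rewrite divr_ge0 ?ler_pdivrMr/= ?mul1r; lra.
have ji : j != i by rewrite eq_sym.
have := convex_hull_convex t01 (IH i j ifr jfr ij) (IH j i jfr ifr ji).
rewrite !sum_transfer -/e -/e'; congr (convex_hull _ _).
rewrite -(opprB (x i) (x j)); move: (x i - x j) => u.
rewrite !scalerDr addrACA -scalerDl [_ + (1 - _)]addrC subrK scale1r.
rewrite !scalerA scalerN -scalerBl.
have -> : e' / (e + e') * e - (1 - e' / (e + e')) * e' = 0 by field.
by rewrite scale0r addr0.
Qed.

End transfer.

(** The right-hand side is convex and contains the [p]-fold sums, whose weights are indicators;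
    [hypersimplex_itv] is the converse. *)
Lemma hypersimplexE (V : lmodType R) (m p : nat) (x : 'I_m -> V) :
  hypersimplex p x = [set y | exists c : 'I_m -> R,
    [/\ forall i, 0 <= c i <= 1, \sum_i c i = p%:R & \sum_i c i *: x i = y]].
Proof.
apply/seteqP; split; last by move=> _ [c [? ? <-]]; exact: hypersimplex_itv.
apply: smallest_sub.
  apply/convex_setP => u v t /andP[t0 t1] [c [c0 c1 <-]] [c' [c'0 c'1 <-]].
  exists (fun i => t * c i + (1 - t) * c' i); split.
  - by move=> i; have := c0 i; have := c'0 i; nra.
  - by rewrite big_split/= -!mulr_sumr c1 c'1 -mulrDl addrC subrK mul1r.
  - rewrite !scaler_sumr -big_split/=; apply: eq_bigr => i _.
    by rewrite scalerDl !scalerA.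
move=> _ [S Sp ->]; exists (fun i => (i \in S)%:R); split.
- by move=> i; case: (i \in S); rewrite ?lexx ler01.
- by rewrite -natr_sum -big_mkcond/= sum1_card Sp.
- rewrite [RHS]big_mkcond/=; apply: eq_bigr => i _.
  by case: ifP; rewrite ?scale1r ?scale0r.
Qed.
End hulls.

(** * Counting integer parts, and measures of finite partitions *)

(** No entry exceeds the sum [q], so the bound [N] excludes nothing and [card_ord_partitions]
    applies after widening the ordinals. *)
Lemma card_bounded_compositions m N q : (q <= N)%N ->
  #|[set t : m.+1.-tuple 'I_N.+1 | (\sum_(i < m.+1) tnth t i == q)%N]%SET| = 'C(m + q, m).
Proof.
move=> qN; rewrite -card_ord_partitions.
have qN' : (q.+1 <= N.+1)%N by [].
pose f (t : m.+1.-tuple 'I_q.+1) : m.+1.-tuple 'I_N.+1 :=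
  [tuple widen_ord qN' (tnth t i) | i < m.+1].
rewrite -(@card_imset _ _ f); last first.
  move=> s t /(congr1 (fun u => tnth u)) st; apply: eq_from_tnth => i.
  have := congr1 (fun u => u i) st; rewrite !tnth_mktuple => /(congr1 val)/= h.
  exact/val_inj.
apply: eq_card => t; rewrite !inE; apply/eqP/imsetP.
  move=> tq.
  have tq' i : (tnth t i < q.+1)%N by rewrite ltnS -tq (bigD1 i)//= leq_addr.
  exists [tuple Ordinal (tq' i) | i < m.+1].
    rewrite inE big_tuple -[X in _ == X]tq; apply/eqP; apply: eq_bigr => i _.
    by rewrite tnth_mktuple.
  by apply: eq_from_tnth => i; rewrite !tnth_mktuple; exact/val_inj.
move=> [s + ->]; rewrite inE big_tuple => /eqP sq; rewrite -[RHS]sq.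
by apply: eq_bigr => i _; rewrite tnth_mktuple.
Qed.

Lemma measure_fin_type_bigcup (disp : measure_display) (R : realType)
    (T : measurableType disp) (mu : {measure set T -> \bar R}) (K : finType)
    (F : K -> set T) : (forall k, measurable (F k)) -> trivIset setT F ->
  mu (\bigcup_(k in [set: K]) F k) = (\sum_(k : K) mu (F k))%E.
Proof.
move=> mF tF; rewrite measure_fin_bigcup//; last exact: finite_finset.
rewrite [RHS]fsbig_seq ?index_enum_uniq//; apply: eq_fsbigl.
by apply/seteqP; split => k //= _; rewrite mem_index_enum.
Qed.

Lemma measurable_tuple_box (R : realType) n (A : 'I_n -> set (measurableTypeR R)) :
  (forall j, measurable (A j)) ->
  measurable [set t : n.-tuple (measurableTypeR R) | forall j, A j (tnth t j)].
Proof.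
move=> mA; have -> : [set t | forall j, A j (tnth t j)] =
    \bigcap_(j in [set: 'I_n])
      ((fun t : n.-tuple (measurableTypeR R) => tnth t j) @^-1` A j).
  by apply/seteqP; split => t /= H j; [move=> _|]; exact: H.
apply: fin_bigcap_measurable => // j _.
by rewrite -[X in measurable X]setTI; exact: measurable_tnth.
Qed.

(** * Cells cut out by barycentric coordinates, and their volumes *)

Section cells.
Context {R : realType} {d : nat}.
Variable x : 'I_d.+1 -> 'rV[R]_d.
Local Notation mR := (measurableTypeR R).
Local Notation mu := (@lebesgue_measure_tuple R d).
Local Notation rowt t := (\row_i tnth t i).

Local Notation closed01 := (fun _ : 'I_d.+1 => `[0 : R, 1 : R]%classic).
Local Notation halfopen01 := (fun _ : 'I_d.+1 => `[0 : R, 1 : R[%classic).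
Local Notation nonneg := (fun _ : 'I_d.+1 => `[0 : R, +oo[%classic).

(** Letting the sum [s] of the coordinates vary covers the simplex, its dilations, their pieces and
    the hypersimplices at once. *)
Definition cell (s : R) (A : 'I_d.+1 -> set R) : set (d.-tuple mR) :=
  [set t | forall i, A i (bary x s (rowt t) i)].

Lemma measurable_bary s i :
  measurable_fun setT (fun t : d.-tuple mR => bary x s (rowt t) i : mR).
Proof.
under eq_fun do rewrite bary_linear.
apply: measurable_funD; first exact: measurable_cst.
apply: measurable_sum => j.
under eq_fun do rewrite mxE.
by apply: measurable_funM; [exact: measurable_cst|exact: measurable_tnth].
Qed.

Lemma measurable_cell s (A : 'I_d.+1 -> set mR) :
  (forall i, measurable (A i)) -> measurable (cell s A).
Proof.
move=> mA; have -> : cell s A = \bigcap_(i in [set: 'I_d.+1])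
    ((fun t : d.-tuple mR => bary x s (rowt t) i : mR) @^-1` A i).
  by apply/seteqP; split => t /= H i; [move=> _|]; exact: H.
apply: fin_bigcap_measurable => // i _.
by rewrite -[X in measurable X]setTI; exact: measurable_bary.
Qed.

Lemma measurable_cell_itv s (A : 'I_d.+1 -> interval R) :
  measurable (cell s (fun i => [set` A i])).
Proof. by apply: measurable_cell => i; exact: measurable_itv. Qed.

(** Translation by [w] adds [c] to the coordinates, hence [s'] to their sum, and preserves
    volume. *)
Lemma cell_shift (s s' : R) (c : 'I_d.+1 -> R) (A : 'I_d.+1 -> set mR) :
  affinely_independent x -> \sum_i c i = s' ->
  (forall i, measurable (A i)) ->
  mu (cell (s + s') (fun i => [set u | A i (u - c i)])) = mu (cell s A).
Proof.
move=> hx cs mA; pose w := \sum_i c i *: x i.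
have := lebesgue_measure_tuple_affine (fun j => - w 0 j) ltr01 (measurable_cell s mA).
rewrite expr1n invr1 mul1e => <-.
have e t i : bary x (s + s') (rowt t) i - c i =
    bary x s (rowt (affine_tuple 1 (fun j => - w 0 j) t)) i.
  rewrite -(bary_unique hx cs (erefl w)).
  have -> : rowt (affine_tuple 1 (fun j => - w 0 j) t) = rowt t - w.
    by apply/rowP => j; rewrite !mxE tnth_mktuple mul1r.
  by rewrite -{1}[rowt t](subrK w) baryD addrK.
by congr (mu _); apply/seteqP; split => t /= h i; have := h i; rewrite /= e.
Qed.

(** The homothety of ratio [a^-1] divides the coordinates and their sum by [a]. *)
Lemma cell_scale (a : R) (A : 'I_d.+1 -> set mR) : 0 < a ->
  (forall i, measurable (A i)) ->
  mu (cell a (fun i => [set u | A i (a^-1 * u)])) = ((a ^+ d)%:E * mu (cell 1 A))%E.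
Proof.
move=> a0 mA; rewrite -[a in (a ^+ d)%R]invrK exprVn.
rewrite -(lebesgue_measure_tuple_affine (fun j => 0)) ?invr_gt0//; last first.
  exact: measurable_cell.
have e t i : a^-1 * bary x a (rowt t) i =
    bary x 1 (rowt (affine_tuple a^-1 (fun j => 0) t)) i.
  rewrite -baryZ mulVf ?gt_eqF//; congr (bary x _ _ _).
  by apply/rowP => j; rewrite !mxE tnth_mktuple addr0.
by congr (mu _); apply/seteqP; split => t /= h i; have := h i; rewrite /= e.
Qed.

Hypothesis hx : affinely_independent x.

Lemma hypersimplex_cell p :
  [set t | hypersimplex p x (rowt t)] = cell p%:R closed01.
Proof.
apply/seteqP; split => t /=; rewrite hypersimplexE /=.
  by move=> [c [c01 cp cy]] i; rewrite (bary_unique hx cp cy)/= in_itv/= c01.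
move=> h; exists (bary x p%:R (rowt t)); split.
- by move=> i; have := h i; rewrite /= in_itv.
- exact: sum_bary.
- exact: sum_bary_scale.
Qed.

(** Nonnegative coordinates of sum 1 are at most 1. The form without upper bounds is the one that is
    dilated and subdivided. *)
Lemma cell1_nonneg :
  cell 1 nonneg = cell 1 closed01.
Proof.
apply/seteqP; split => t /= h i; have := h i; rewrite /= !in_itv/= ?andbT.
  move=> ->/=; rewrite -[leRHS](sum_bary hx 1 (rowt t)) (bigD1 i)//= lerDl sumr_ge0// => j _.
  by have := h j; rewrite /= in_itv/= andbT.
by case/andP.
Qed.

(** Weights in [0, 1] bound the [j]-th coordinate of the point by [B j], so the cell lies in a
    box. *)
Lemma cell_unit_lt_oo s : (mu (cell s closed01) < +oo)%E.
Proof.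
pose B (j : 'I_d) := \sum_i `|x i 0 j|.
pose A (j : 'I_d) : set mR := `[- B j, B j]%classic.
apply: (@le_lt_trans _ _ (mu [set t | forall j, A j (tnth t j)])).
  apply: le_measure; rewrite ?inE; first exact: measurable_cell_itv.
    by apply: (@measurable_tuple_box _ _ A) => j; exact: measurable_itv.
  move=> t /= h j; rewrite /A/= in_itv/= -ler_norml.
  have -> : tnth t j = (rowt t : 'rV[R]_d) 0 j by rewrite mxE.
  rewrite -[X in `|fun_of_matrix X _ _|](sum_bary_scale hx s) summxE.
  apply: le_trans (ler_norm_sum _ _ _) _; apply: ler_sum => i _.
  rewrite mxE normrM ler_piMl//.
  by have := h i; rewrite /= in_itv/= => /andP[? ?]; rewrite ger0_norm.
rewrite lebesgue_measure_tuple_box => [|j]; last exact: measurable_itv.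
rewrite -ge0_fin_numE ?prode_ge0//; apply: prode_fin_num => j _.
by rewrite [X in X \is a _]lebesgue_measure_itv; case: ifP.
Qed.

(** The simplex contains a small cube around its centroid [y0], where all barycentric coordinates
    equal 1 / (d + 1). *)
Lemma cell1_unit_gt0 : (0 < mu (cell 1 closed01))%E.
Proof.
rewrite -cell1_nonneg.
pose a i j := bary x 0 (delta_mx 0 j) i.
(* [S] bounds the variation of each barycentric coordinate per unit of sup norm; the summand 1 makes
   it positive. With [e] below, [S * e] is 1 / (d + 1). *)
pose S := 1 + \sum_i \sum_j `|a i j|.
have S0 : 0 < S by rewrite ltr_pwDl// !sumr_ge0// => i _; rewrite sumr_ge0.
pose e := d.+1%:R^-1 / S.
have e0 : 0 < e by rewrite divr_gt0// invr_gt0 ltr0n.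
pose y0 : 'rV[R]_d := \sum_i d.+1%:R^-1 *: x i.
have y0E i : bary x 1 y0 i = d.+1%:R^-1.
  rewrite (bary_unique hx (c := fun=> d.+1%:R^-1))// sumr_const card_ord.
  by rewrite -[LHS]mulr_natr mulVf// pnatr_eq0.
pose A (j : 'I_d) : set mR := `[y0 0 j - e, y0 0 j + e]%classic.
apply: (@lt_le_trans _ _ (mu [set t | forall j, A j (tnth t j)])).
  rewrite lebesgue_measure_tuple_box => [|j]; last exact: measurable_itv.
  rewrite (eq_bigr (fun=> (e *+ 2)%:E)); last first.
    move=> j _; rewrite [LHS]lebesgue_measure_itv/= lte_fin.
    rewrite ifT; last by lra.
    by rewrite -EFinB; congr EFin; lra.
  by rewrite prodEFin lte_fin prodr_gt0// => j _; rewrite mulrn_wgt0.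
apply: le_measure; rewrite ?inE; last first.
- move=> t /= h i; rewrite /= in_itv/= andbT.
  have -> : bary x 1 (rowt t) i = d.+1%:R^-1 +
      \sum_j a i j * (tnth t j - y0 0 j).
    rewrite -(y0E i) bary_linear [in RHS]bary_linear -addrA; congr +%R.
    by rewrite -big_split/=; apply: eq_bigr => j _; rewrite mxE -mulrDr addrC subrK.
  rewrite -lerBlDl sub0r lerNl.
  apply: le_trans (ler_norm _) _; rewrite normrN.
  apply: le_trans (ler_norm_sum _ _ _) _.
  apply: (@le_trans _ _ (S * e)); last by rewrite /e mulrCA mulfV ?gt_eqF// mulr1.
  apply: (@le_trans _ _ (\sum_j `|a i j| * e)).
    apply: ler_sum => j _; rewrite normrM ler_wpM2l//.
    by have := h j; rewrite /A/= in_itv/= ler_distl.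
  rewrite -mulr_suml ler_wpM2r ?(ltW e0)// /S (bigD1 i)//= addrCA lerDl.
  by rewrite addr_ge0// sumr_ge0// => k _; rewrite sumr_ge0.
- exact: measurable_cell_itv.
- by apply: (@measurable_tuple_box _ _ A) => j; exact: measurable_itv.
Qed.

(** The level set is a hyperplane: were the linear part zero, the coordinate would be constant, yet
    it is 1 at [x i] and 0 at another vertex, which exists as [d > 0]. *)
Lemma bary_level_null s i b : (0 < d)%N ->
  mu.-negligible [set t | bary x s (rowt t) i = b].
Proof.
move=> d0; pose a j := bary x 0 (delta_mx 0 j) i.
have aE t : bary x s (rowt t) i = bary x s 0 i + \sum_j a j * tnth t j.
  by rewrite bary_linear; congr +%R; apply: eq_bigr => j _; rewrite mxE.
have a0 : exists j, a j != 0.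
  apply: contrapT => na.
  have a0 j : a j = 0 by apply/eqP/negPn/negP => h; apply: na; exists j.
  have cst y : bary x 1 y i = bary x 1 0 i.
    by rewrite bary_linear big1 ?addr0// => j _; rewrite -/(a j) a0 mul0r.
  have vert k : bary x 1 (x k) i = (i == k)%:R.
    rewrite (bary_unique hx (c := fun i => (i == k)%:R))//.
      by rewrite (bigD1 k)//= eqxx big1 ?addr0// => j /negPf ->.
    rewrite (bigD1 k)//= eqxx scale1r big1 ?addr0// => j /negPf ->.
    by rewrite scale0r.
  have [k ik] : exists k : 'I_d.+1, i != k.
    have [->|i0] := eqVneq i ord0; last by exists ord0.
    by exists (Ordinal (d0 : (1 < d.+1)%N)).
  have := vert i; rewrite cst -(cst (x k)) vert eqxx (negPf ik).
  by move/esym/eqP; rewrite oner_eq0.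
have mS : measurable [set t : d.-tuple mR | bary x s (rowt t) i = b].
  rewrite -[X in measurable X]setTI.
  apply: (@measurable_bary s i measurableT [set b]); exact: measurable_set1.
apply/negligibleP => //.
rewrite -(lebesgue_measure_tuple_hyperplane (b - bary x s 0 i) a0).
congr (mu _); apply/seteqP; split => t /=; rewrite aE.
  by move=> <-; rewrite addrC addKr.
by move=> ->; rewrite addrC subrK.
Qed.

Lemma cell_halfopen01 s : (0 < d)%N -> mu (cell s closed01) = mu (cell s halfopen01).
Proof.
move=> d0.
have mc := measurable_cell_itv s (fun=> `[0, 1]).
have mo := measurable_cell_itv s (fun=> `[0, 1[).
have oc : cell s halfopen01 `<=` cell s closed01.
  move=> t h i; have := h i; rewrite /= !in_itv/= => /andP[-> /ltW ->]//.
rewrite -(setDUK oc) measureU0//; first exact: measurableD.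
apply/negligibleP; first exact: measurableD.
(* The points removed have some coordinate equal to 1. The union runs over all naturals; [inord]
   sends those above [d] to [ord0], which only repeats a null set. *)
apply: (@negligibleS _ _ _ mu (\bigcup_k [set t | bary x s (rowt t) (inord k) = 1])).
  move=> t [/= tc to]; apply: contrapT => nt; apply: to => i.
  have := tc i; rewrite /= !in_itv/= => /andP[-> t1]/=; rewrite lt_neqAle t1 andbT.
  by apply/eqP => ti; apply: nt; exists i => //=; rewrite inord_val.
by apply: negligible_bigcup => k; exact: bary_level_null.
Qed.

Lemma cell0_halfopen01 : (0 < d)%N -> mu (cell 0 halfopen01) = 0%E.
Proof.
move=> d0; apply/negligibleP; first exact: measurable_cell_itv.
apply: negligibleS (bary_level_null 0 ord0 0 d0) => t /= h.
have h0 i : 0 <= bary x 0 (rowt t) i by have := h i; rewrite /= in_itv/= => /andP[].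
have /psumr_eq0P -> // : \sum_i bary x 0 (rowt t) i = 0 by exact: sum_bary.
Qed.

Lemma cell_gt_halfopen01 p : (d < p)%N -> cell p%:R halfopen01 = set0.
Proof.
move=> dp; apply/seteqP; split => // t h.
have : \sum_i bary x p%:R (rowt t) i < \sum_(i < d.+1) 1.
  apply: ltr_sum; last by move=> i _; have := h i; rewrite /= in_itv/= => /andP[].
  by apply/hasP; exists ord0; rewrite ?mem_index_enum.
by rewrite sum_bary// sumr_const card_ord ltr_nat ltnNge dp.
Qed.

Lemma dilated_simplex_volume n : (0 < n)%N ->
  ((n%:R ^+ d)%:E * mu (cell 1 closed01) =
   \sum_(p < n.+1) mu (cell p%:R halfopen01) *+ 'C(n + d - p, n - p))%E.
Proof.
move=> n0.
have n0' : 0 < n%:R :> R by rewrite ltr0n.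
rewrite -cell1_nonneg -cell_scale//.
(* The coordinates are nonnegative of sum [n], so their integer parts are at most [n] and a finite
   type indexes the pieces. *)
pose K := d.+1.-tuple 'I_n.+1.
pose F (k : K) := cell n%:R (fun i => `[(tnth k i)%:R : R, (tnth k i).+1%:R : R[%classic).
have -> : cell n%:R (fun i => [set u | nonneg i (n%:R^-1 * u)]) =
    \bigcup_(k in [set: K]) F k.
  apply/seteqP; split => t.
    move=> h; have h0 i : 0 <= bary x n%:R (rowt t) i.
      by have := h i; rewrite /= in_itv/= andbT pmulr_rge0 ?invr_gt0.
    have hn i : (Num.truncn (bary x n%:R (rowt t) i) < n.+1)%N.
      rewrite truncn_lt_nat//; apply: (@le_lt_trans _ _ n%:R); last by rewrite ltr_nat.
      rewrite -[leRHS](sum_bary hx n%:R (rowt t)) (bigD1 i)//= lerDl sumr_ge0//.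
    exists [tuple Ordinal (hn i) | i < d.+1] => // i.
    by rewrite tnth_mktuple/= in_itv/= truncn_itv.
  move=> [k _ h] i; have := h i; rewrite /= !in_itv/= andbT => /andP[+ _].
  by move=> /(le_trans (ler0n _ _)) ?; rewrite mulr_ge0// invr_ge0 ltW.
have mF k : measurable (F k) by exact: measurable_cell_itv.
have tF : trivIset setT F.
  move=> k k' _ _ [t [h h']]; apply: eq_from_tnth => i; apply/val_inj.
  have := h i; have := h' i; rewrite /= !in_itv/= => /truncn_def <- /truncn_def <-//.
rewrite measure_fin_type_bigcup//.
pose S (k : K) := (\sum_i tnth k i)%N.
have FE (k : K) (p : nat) : (S k + p = n)%N -> mu (F k) = mu (cell p%:R halfopen01).
  move=> kp.
  rewrite -(@cell_shift p%:R (S k)%:R (fun i => (tnth k i)%:R))//; last first.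
    by rewrite -natr_sum.
  rewrite -natrD addnC kp; congr (mu _); apply/seteqP; split => t h i;
    have := h i; rewrite /= !in_itv/= subr_ge0 ltrBlDr nat1r//.
have F0 (k : K) : (n < S k)%N -> mu (F k) = 0%E.
  move=> nk; rewrite [F k](_ : _ = set0) ?measure0//.
  apply/seteqP; split => // t h.
  have : (S k)%:R <= \sum_i bary x n%:R (rowt t) i.
    rewrite /S natr_sum; apply: ler_sum => i _.
    by have := h i; rewrite /= in_itv/= => /andP[].
  by rewrite sum_bary// ler_nat leqNgt nk.
rewrite (bigID (fun k => (S k <= n)%N))/= [X in (_ + X)%E]big1 ?adde0; last first.
  by move=> k; rewrite -ltnNge => /F0.
(* Pieces are grouped by [p = n - S k], the sum left to the fractional parts; [inord] is exact since
   this is at most [n]. *)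
rewrite (partition_big (fun k => inord (n - S k) : 'I_n.+1) predT)//=.
apply: eq_bigr => p _.
have pn : (p <= n)%N by rewrite -ltnS.
rewrite (eq_bigr (fun=> mu (cell p%:R halfopen01))); last first.
  move=> k /andP[kn /eqP kp]; apply: FE.
  by rewrite -kp inordK ?ltnS ?leq_subr// subnKC.
rewrite [LHS](_ : _ = mu (cell p%:R halfopen01) *+ #|[set k : K | (S k == n - p)%N]%SET|).
  rewrite card_bounded_compositions ?leq_subr//.
  by rewrite -bin_sub ?leq_addr// addKn addnC addnBAC// addnC.
rewrite -sumr_const; apply: eq_bigl => k; rewrite inE.
rewrite -val_eqE/= inordK ?ltnS ?leq_subr//.
by apply/andP/eqP => [[kn /eqP <-]|->]; lia.
Qed.

End cells.

(** * Comparison of the two finite sums *)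

Theorem theorem16 (R : realType) (d n : nat) (hd : (1 <= d)%N) (hn : (1 <= n)%N)
    (x : 'I_d.+1 -> 'rV[R]_d) (hx : affinely_independent x) :
  \sum_(1 <= p < d.+1)
     relvol p x * (if (p <= n)%N then 'C(n + d - p, n - p) else 0%N)%:R
  = n%:R ^+ d.
Proof.
pose H (p : nat) := lebesgue_measure_tuple d (cell x p%:R (fun=> `[0 : R, 1 : R[%classic)).
have volE p : vol (hypersimplex p x) = H p.
  by rewrite /H -cell_halfopen01// -hypersimplex_cell.
have H1 : vol (simplex x) = H 1%N by rewrite simplex_hypersimplex1 volE.
(* Finite volumes and a nonzero denominator make [fine] and the quotient in [relvol] faithful. *)
have Hfin p : H p \is a fin_num.
  by rewrite ge0_fin_numE ?measure_ge0// /H -cell_halfopen01// cell_unit_lt_oo.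
have H1gt0 : 0 < fine (H 1%N).
  by rewrite fine_gt0// ltey_eq Hfin /H -cell_halfopen01// cell1_unit_gt0.
have := dilated_simplex_volume hx hn.
rewrite cell_halfopen01// -[cell x 1]/(cell x 1%:R) -/(H 1%N).
move=> /(congr1 fine); rewrite fineM// /= => dil.
(* The guard matters: for [p > n] truncated subtraction gives [n - p = 0], and the bare binomial
   would be 1. *)
pose C p := (if (p <= n)%N then 'C(n + d - p, n - p) else 0%N).
pose F p : R := fine (H p) * (C p)%:R.
have {}dil : n%:R ^+ d * fine (H 1%N) = \sum_(0 <= p < n.+1) F p.
  rewrite dil big_mkord (eq_bigr (fun p : 'I_n.+1 => (F p)%:E)) ?sumEFin// => p _.
  by rewrite /F /C -ltnS ltn_ord mulr_natr EFin_natmul fineK.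
have F0 : F 0%N = 0 by rewrite /F /H cell0_halfopen01//= mul0r.
have Fd p : (d < p)%N -> F p = 0.
  by move=> dp; rewrite /F /H cell_gt_halfopen01// measure0/= mul0r.
have Fn p : (n < p)%N -> F p = 0.
  by move=> np; rewrite /F /C leqNgt np mulr0.
apply: (mulIf (lt0r_neq0 H1gt0)); rewrite dil mulr_suml.
rewrite (eq_bigr F); last first.
  by move=> p _; rewrite /relvol volE H1 mulrAC divfK ?gt_eqF.
(* Both sums extend to a common range: the terms with [p = 0] or [p > d] have zero volume, those
   with [p > n] a zero coefficient. *)
transitivity (\sum_(0 <= p < d.+1 + n) F p).
  rewrite [RHS](@big_cat_nat _ _ _ d.+1)//= ?leq_addr// [X in _ + X]big1_seq ?addr0.
    by rewrite [RHS]big_ltn// F0 add0r.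
  by move=> p /andP[_]; rewrite mem_index_iota => /andP[/Fd].
rewrite (@big_cat_nat _ _ _ n.+1)//= ?addSn ?ltnS ?leq_addl// [X in _ + X]big1_seq ?addr0//.
by move=> p /andP[_]; rewrite mem_index_iota => /andP[/Fn].
Qed.
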